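(* (a) Let $f:X\to Y$ be a perfect map between zero-dimensional locally compact Hausdorff spaces. Then $f$ is a quasi-open map iff the Boolean homomorphism $\Theta^t(f):CO(Y)\to CO(X)$, $G\mapsto f^{-1}(G)$, is complete. In particular, if $f:X\to Y$ is a continuous map between compact zero-dimensional Hausdorff spaces, then $f$ is a quasi-open map iff its Stone dual $S^t(f):CO(Y)\to CO(X)$, $G\mapsto f^{-1}(G)$, is complete. (b) The category $\mathbf{QPZLC}$ of all zero-dimensional locally compact Hausdorff spaces and all quasi-open perfect maps is dually equivalent to the category $\mathbf{QPZLBA}$ whose objects are all ZLB-algebras and whose morphisms are all $\mathbf{ZLBA}$-morphisms $\varphi:(A,I)\to(B,J)$ such that $\varphi(I)\subseteq J$ and $\varphi:A\to B$ is a complete Boolean homomorphism. (c) The category $\mathbf{QZHC}$ of compact zero-dimensional Hausdorff spaces and (continuous) quasi-open maps is dually equivalent to the category $\mathbf{BoolC}$ of Boolean algebras and complete Boolean homomorphisms.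
   Context: A space is zero-dimensional if its clopen subsets form a base. $CO(X)$ is the Boolean algebra of clopen subsets of $X$. A perfect map is a continuous closed map with compact fibres. A map $f:X\to Y$ is quasi-open if $\mathrm{int}(f(U))\neq\emptyset$ for every non-empty open $U\subseteq X$. All maps between spaces considered here are continuous. For a distributive $\{0\}$-pseudolattice $I$ (a poset with least element $0$ and all finite non-empty meets and joins, distributive), $Idl(I)$ is the frame of all ideals of $I$; for $J\in Idl(I)$, $\neg J=\{a\in I : a\wedge b=0\ \text{for all } b\in J\}$. The ideal $J$ is simple if $J\vee\neg J=I$ in $Idl(I)$; $Si(I)$ is the set of simple ideals. A local Boolean algebra (LBA) is a pair $(A,I)$, where $A$ is a Boolean algebra and $I$ is an ideal of $A$ (possibly non-proper) which is dense in $A$, i.e. for every $a\in A\setminus\{0\}$ there is $b\in I\setminus\{0\}$ with $b\le a$. An LBA $(B,I)$ is a ZLB-algebra (ZLBA) if for every $J\in Si(I)$ the join $\bigvee_B J$ exists in $B$. The category $\mathbf{ZLBA}$ has ZLBAs as objects; its morphisms $\varphi:(A,I)\to(B,J)$ are the Boolean homomorphisms $\varphi:A\to B$ such that for every $b\in J$ there exists $a\in I$ with $b\le\varphi(a)$; composition is the usual composition of functions. A Boolean homomorphism $\varphi$ is complete if it preserves all joins that happen to exist: if a family $\{a_i\}$ in the domain has join $a$, then $\{\varphi(a_i)\}$ has a join and this join is $\varphi(a)$. Two categories are dually equivalent if one is equivalent to the opposite of the other. *)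

(* Defs.v *)
Set Warnings "-notation-overridden,-notation-incompatible-prefix,-redundant-canonical-projection,-projection-no-head-constant".
From HB Require Import structures.
From mathcomp Require Import all_boot all_order.
From mathcomp Require Import boolp classical_sets functions topology.

Set Implicit Arguments.
Unset Strict Implicit.
Unset Printing Implicit Defensive.

Import Order.TTheory.

Local Open Scope classical_set_scope.

Structure category := Category {
  obj :> Type;
  hom : obj -> obj -> Type;
  idm : forall a, hom a a;
  comp : forall a b c, hom b c -> hom a b -> hom a c;
  comp1m : forall a b (f : hom a b), comp (idm b) f = f;
  compm1 : forall a b (f : hom a b), comp f (idm a) = f;
  compmA : forall a b c d (h : hom c d) (g : hom b c) (f : hom a b),
    comp h (comp g f) = comp (comp h g) f }.

Definition opposite (C : category) : category :=
  @Category C (fun a b => hom b a) (@idm C) (fun a b c g f => comp f g)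
    (fun a b f => compm1 f) (fun a b f => comp1m f)
    (fun a b c d h g f => esym (compmA f g h)).

Structure functor (C D : category) := Functor {
  fobj :> C -> D;
  fmap : forall a b, hom a b -> hom (fobj a) (fobj b);
  fmap1 : forall a, fmap (idm a) = idm (fobj a);
  fmapM : forall a b c (g : hom b c) (f : hom a b),
    fmap (comp g f) = comp (fmap g) (fmap f) }.

Definition functor_id (C : category) : functor C C :=
  @Functor C C id (fun a b f => f) (fun=> erefl) (fun a b c g f => erefl).

Section functor_comp.
Variables (C D E : category) (G : functor D E) (F : functor C D).

Let GF_map (a b : C) (f : hom a b) : hom (G (F a)) (G (F b)) :=
  fmap G (fmap F f).

Let GF_map1 a : GF_map (idm a) = idm (G (F a)).
Proof. by rewrite /GF_map !fmap1. Qed.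

Let GF_mapM a b c (g : hom b c) (f : hom a b) :
  GF_map (comp g f) = comp (GF_map g) (GF_map f).
Proof. by rewrite /GF_map !fmapM. Qed.

Definition functor_comp : functor C E := Functor GF_map1 GF_mapM.

End functor_comp.

Definition isomorphism (C : category) (a b : C) (f : hom a b) : Prop :=
  exists g : hom b a, comp g f = idm a /\ comp f g = idm b.

Definition naturally_isomorphic (C D : category) (F G : functor C D) : Prop :=
  exists eta : forall a, hom (F a) (G a),
    (forall a, isomorphism (eta a)) /\
    (forall a b (f : hom a b), comp (eta b) (fmap F f) = comp (fmap G f) (eta a)).

Definition equivalent (C D : category) : Prop :=
  exists (F : functor C D) (G : functor D C),
    naturally_isomorphic (functor_comp G F) (functor_id C) /\
    naturally_isomorphic (functor_comp F G) (functor_id D).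

Definition dually_equivalent (C D : category) : Prop :=
  equivalent C (opposite D).

Section concrete_category.
Variables (O : Type) (carrier : O -> Type).
Variable P : forall a b : O, (carrier a -> carrier b) -> Prop.
Hypothesis P_id : forall a, P (@id (carrier a)).
Hypothesis P_comp : forall a b c (g : carrier b -> carrier c)
  (f : carrier a -> carrier b), P g -> P f -> P (g \o f).

Let chom a b := {f : carrier a -> carrier b | P f}.
Let cid a : chom a a := exist _ id (P_id a).
Let ccomp a b c (g : chom b c) (f : chom a b) : chom a c :=
  exist _ (sval g \o sval f) (P_comp (svalP g) (svalP f)).

Let chom_inj a b (f g : chom a b) : sval f = sval g -> f = g.
Proof. by case: f g => f Pf [g Pg] /= fg; exact: eq_exist. Qed.

Let ccomp1m a b (f : chom a b) : ccomp (cid b) f = f.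
Proof. exact: chom_inj. Qed.

Let ccompm1 a b (f : chom a b) : ccomp f (cid a) = f.
Proof. exact: chom_inj. Qed.

Let ccompmA a b c d (h : chom c d) (g : chom b c) (f : chom a b) :
  ccomp h (ccomp g f) = ccomp (ccomp h g) f.
Proof. exact: chom_inj. Qed.

Definition concrete_category : category := Category ccomp1m ccompm1 ccompmA.

End concrete_category.

(* This is not [separation_axioms.zero_dimensional], which only asks that
   distinct points be separated by a clopen set. *)
Definition zero_dim (X : topologicalType) : Prop := basis (@clopen X).

Record perfect_map (X Y : topologicalType) (f : X -> Y) : Prop := PerfectMap {
  perfect_continuous : continuous f;
  perfect_closed : forall A : set X, closed A -> closed (f @` A);
  perfect_fibre : forall y : Y, compact (f @^-1` [set y]) }.

Definition quasi_open (X Y : topologicalType) (f : X -> Y) : Prop :=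
  forall U : set X, open U -> U !=set0 -> (f @` U)° !=set0.

Lemma perfect_map_id (X : topologicalType) : perfect_map (@id X).
Proof.
split=> [x|A|y]; first exact: cvg_id.
- by rewrite image_id.
- by rewrite preimage_id; exact: compact_set1.
Qed.

Lemma perfect_preimage_compact (X Y : topologicalType) (f : X -> Y) (K : set Y) :
  perfect_map f -> compact K -> compact (f @^-1` K).
Proof.
move=> pf cK F FF FK.
have [y [Ky Fy]] := cK (f @ F) _ FK.
pose B (A : set X) := closure A `&` f @^-1` [set y].
have BF : ProperFilter (filter_from F B).
  apply: filter_from_proper.
    apply: filter_from_filter; first by exists setT; exact: filterT.
    move=> A A' FA FA'; exists (A `&` A'); first exact: filterI.
    by move=> x [/closureI[? ?] ?].
  move=> A FA; suff [x] : (f @` closure A) y by exists x.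
  apply: (perfect_closed pf (@closed_closure _ A)) => V yV.
  have FfA : F (f @^-1` (f @` A)).
    by apply: filterS FA => x Ax; exists x.
  have [_ [[x Ax <-] Vx]] := Fy (f @` A) V FfA yV.
  by exists (f x); split=> //; exists x => //; exact: subset_closure.
have cfib : compact (f @^-1` [set y]) by exact: perfect_fibre.
have [|x [fx Bx]] := cfib _ BF.
  by exists setT; [exact: filterT|move=> x []].
exists x; split; first by rewrite /preimage/= fx.
move=> A V FA xV.
have [z [[Az _]]] : B A `&` V° !=set0.
  by apply: Bx; [exists A|exact/nbhs_interior].
by move=> /Az.
Qed.

Lemma perfect_map_comp (X Y Z : topologicalType) (g : Y -> Z) (f : X -> Y) :
  perfect_map g -> perfect_map f -> perfect_map (g \o f).
Proof.
move=> pg pf; split.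
- by move=> x; apply: continuous_comp;
    [exact: (perfect_continuous pf)|exact: (perfect_continuous pg)].
- move=> A cA; rewrite -image_comp.
  exact/(perfect_closed pg)/(perfect_closed pf).
- move=> z; rewrite comp_preimage.
  exact/(perfect_preimage_compact pf)/(perfect_fibre pg).
Qed.

Lemma quasi_open_id (X : topologicalType) : quasi_open (@id X).
Proof. by move=> U oU U0; rewrite image_id; move/interior_id: oU => ->. Qed.

Lemma quasi_open_comp (X Y Z : topologicalType) (g : Y -> Z) (f : X -> Y) :
  quasi_open g -> quasi_open f -> quasi_open (g \o f).
Proof.
move=> qg qf U oU /(qf _ oU)/(qg _ (@open_interior _ _))[z zfU].
exists z; rewrite -image_comp; apply: interiorS zfU.
by apply: image_subset; exact: interior_subset.
Qed.

Definition clopenb (X : topologicalType) : pred (set X) := fun A => `[< clopen A >].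

Record CO (X : topologicalType) := MkCO {
  co_set :> set X;
  co_subproof : clopenb co_set }.

HB.instance Definition _ (X : topologicalType) := [isSub for @co_set X].
HB.instance Definition _ (X : topologicalType) := [Choice of CO X by <:].

Section CO_boolean_algebra.
Variable X : topologicalType.

Let CO_meet : {in @clopenb X &, forall A B, (A `&` B)%O \in @clopenb X}.
Proof. by move=> A B /asboolP cA /asboolP cB; apply/asboolP; exact: clopenI. Qed.

Let CO_join : {in @clopenb X &, forall A B, (A `|` B)%O \in @clopenb X}.
Proof. by move=> A B /asboolP cA /asboolP cB; apply/asboolP; exact: clopenU. Qed.

Let CO_bot : (\bot : set X)%O \in @clopenb X.
Proof. by apply/asboolP; exact: clopen0. Qed.

Let CO_top : (\top : set X)%O \in @clopenb X.
Proof. by apply/asboolP; exact: clopenT. Qed.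

HB.instance Definition _ :=
  Order.SubChoice_isTBSubLattice.Build set_display (set X) (@clopenb X)
    set_display (CO X) CO_meet CO_join CO_bot CO_top.

Let CO_meetUl : left_distributive (@Order.meet _ (CO X)) Order.join.
Proof.
by move=> A B C; apply: val_inj; exact: setIUl.
Qed.

HB.instance Definition _ :=
  Order.Lattice_Meet_isDistrLattice.Build set_display (CO X) CO_meetUl.

Let CO_complP (A : CO X) : clopenb (~` A).
Proof. by apply/asboolP/(clopenC A)/asboolP/(co_subproof A). Qed.

Let CO_compl (A : CO X) : CO X := MkCO (CO_complP A).

Let CO_joinxC A : (A `|` CO_compl A = \top)%O.
Proof. by apply: val_inj; exact: setUCr. Qed.

Let CO_meetxC A : (A `&` CO_compl A = \bot)%O.
Proof. by apply: val_inj; exact: setICr. Qed.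

HB.instance Definition _ :=
  Order.TBDistrLattice_hasComplement.Build set_display (CO X) CO_joinxC CO_meetxC.

End CO_boolean_algebra.

Section boolean_homomorphisms.
Context {d d' : Order.disp_t}.
Context {A : ctbDistrLatticeType d} {B : ctbDistrLatticeType d'}.

(* The library's {lmorphism _ -> _} does not preserve \bot and \top, and its
   {tblmorphism _ -> _} does not preserve meets and joins. *)
Record boolean_hom (phi : A -> B) : Prop := BooleanHom {
  boolean_hom0 : phi \bot%O = \bot%O;
  boolean_hom1 : phi \top%O = \top%O;
  boolean_homI : Order.meet_morphism phi;
  boolean_homU : Order.join_morphism phi;
  boolean_homC : {morph phi : a / (~` a)%O} }.

(* [supremums S a] says that [a] is the join of [S]. *)
Definition preserves_joins (phi : A -> B) : Prop :=
  forall (S : set A) (a : A), supremums S a -> supremums (phi @` S) (phi a).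

Definition complete_boolean_hom (phi : A -> B) : Prop :=
  boolean_hom phi /\ preserves_joins phi.

End boolean_homomorphisms.

Lemma complete_boolean_hom_id d (A : ctbDistrLatticeType d) :
  complete_boolean_hom (@id A).
Proof. by split=> // S a Sa; rewrite image_id. Qed.

Lemma complete_boolean_hom_comp d1 d2 d3 (A : ctbDistrLatticeType d1)
    (B : ctbDistrLatticeType d2) (C : ctbDistrLatticeType d3)
    (psi : B -> C) (phi : A -> B) :
  complete_boolean_hom psi -> complete_boolean_hom phi ->
  complete_boolean_hom (psi \o phi).
Proof.
move=> [bpsi jpsi] [bphi jphi]; split.
  split=> [||a b|a b|a] /=.
  - by rewrite !boolean_hom0.
  - by rewrite !boolean_hom1.
  - by rewrite (boolean_homI bphi) (boolean_homI bpsi).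
  - by rewrite (boolean_homU bphi) (boolean_homU bpsi).
  - by rewrite (boolean_homC bphi) (boolean_homC bpsi).
by move=> S a Sa; rewrite -image_comp; exact/jpsi/jphi.
Qed.

Section clopen_preimage.
Variables (X Y : topologicalType) (f : X -> Y) (cf : continuous f).

Let clopen_preimage_subproof (G : CO Y) : clopenb (f @^-1` G).
Proof.
by apply/asboolP; apply: preimage_clopen cf; exact/asboolP/(co_subproof G).
Qed.

Definition clopen_preimage (G : CO Y) : CO X :=
  MkCO (clopen_preimage_subproof G).

Lemma clopen_preimage_boolean_hom : boolean_hom clopen_preimage.
Proof. by split=> [||G H|G H|G]; exact: val_inj. Qed.

End clopen_preimage.

Section ideals.
Context {d : Order.disp_t} {L : bDistrLatticeType d}.
Implicit Types J K : set L.

Record is_ideal J : Prop := IsIdeal {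
  ideal0 : J \bot%O;
  ideal_le : forall a b : L, (a <= b)%O -> J b -> J a;
  idealU : forall a b : L, J a -> J b -> J (a `|` b)%O }.

Definition ideal_join J K : set L := smallest is_ideal (J `|` K).

Definition ideal_neg J : set L :=
  [set a | forall b, J b -> (a `&` b)%O = \bot%O].

Definition simple_ideal J : Prop :=
  is_ideal J /\ ideal_join J (ideal_neg J) = setT.

End ideals.

Record ideal d (L : bDistrLatticeType d) := Ideal {
  ideal_set :> set L;
  idealP : is_ideal ideal_set }.

Section ideal_lattice.
Context {d : Order.disp_t} {L : bDistrLatticeType d} (I : ideal L).

Definition idealb : pred L := fun a => `[< ideal_set I a >].

Record ideal_elt := IdealElt {
  ideal_val :> L;
  ideal_elt_subproof : idealb ideal_val }.

HB.instance Definition _ := [isSub for ideal_val].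
HB.instance Definition _ := [Choice of ideal_elt by <:].

Let ideal_elt_meet : {in idealb &, forall a b, (a `&` b)%O \in idealb}.
Proof.
by move=> a b /asboolP Ia _; apply/asboolP; apply: (ideal_le (idealP I)) Ia; exact: leIl.
Qed.

Let ideal_elt_join : {in idealb &, forall a b, (a `|` b)%O \in idealb}.
Proof. by move=> a b /asboolP Ia /asboolP Ib; apply/asboolP/(idealU (idealP I)). Qed.

Let ideal_elt_bot : \bot%O \in idealb.
Proof. exact/asboolP/(ideal0 (idealP I)). Qed.

HB.instance Definition _ :=
  Order.SubChoice_isBSubLattice.Build d L idealb d ideal_elt
    ideal_elt_meet ideal_elt_join ideal_elt_bot.

Let ideal_elt_meetUl : left_distributive (@Order.meet _ ideal_elt) Order.join.
Proof.
by move=> a b c; apply: val_inj; exact: (@meetUl _ L).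
Qed.

HB.instance Definition _ :=
  Order.Lattice_Meet_isDistrLattice.Build d ideal_elt ideal_elt_meetUl.

End ideal_lattice.

Record boolean_algebra := BooleanAlgebra {
  ba_disp : Order.disp_t;
  ba_sort :> ctbDistrLatticeType ba_disp }.

Definition dense_ideal d (A : ctbDistrLatticeType d) (I : set A) : Prop :=
  forall a, a != \bot%O -> exists b, [/\ I b, b != \bot%O & (b <= a)%O].

Record local_boolean_algebra := LocalBooleanAlgebra {
  lba_alg :> boolean_algebra;
  lba_ideal : ideal lba_alg;
  lba_dense : dense_ideal lba_ideal }.

(* The simple ideals are those of the pseudolattice [ideal_elt I]; their joins
   are taken in the whole Boolean algebra. *)
Definition is_zlba (A : local_boolean_algebra) : Prop :=
  forall J : set (ideal_elt (lba_ideal A)), simple_ideal J ->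
    exists a : A, supremums (@ideal_val _ _ (lba_ideal A) @` J) a.

Record zlb_algebra := ZLBAlgebra {
  zlba_lba :> local_boolean_algebra;
  zlbaP : is_zlba zlba_lba }.

Definition zlba_morphism (A B : zlb_algebra) (phi : A -> B) : Prop :=
  boolean_hom phi /\
  forall b, ideal_set (lba_ideal B) b ->
    exists2 a, ideal_set (lba_ideal A) a & (b <= phi a)%O.

Definition qpzlba_morphism (A B : zlb_algebra) (phi : A -> B) : Prop :=
  [/\ zlba_morphism phi,
      phi @` lba_ideal A `<=` lba_ideal B
    & complete_boolean_hom phi].

Lemma qpzlba_morphism_id (A : zlb_algebra) : qpzlba_morphism (@id A).
Proof.
split; [|by rewrite image_id|exact: complete_boolean_hom_id].
by split=> // b Ib; exists b.
Qed.

Lemma qpzlba_morphism_comp (A B C : zlb_algebra) (psi : B -> C) (phi : A -> B) :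
  qpzlba_morphism psi -> qpzlba_morphism phi -> qpzlba_morphism (psi \o phi).
Proof.
move=> [[bpsi zpsi] Ipsi cpsi] [[bphi zphi] Iphi cphi].
have ccomp := complete_boolean_hom_comp cpsi cphi.
split=> //; first split; first exact: ccomp.1.
  move=> c /zpsi[b /zphi[a Ia ba] cb]; exists a => //.
  apply: le_trans cb _; rewrite leEmeet -(boolean_homI bpsi).
  by move: ba; rewrite leEmeet => /eqP ->.
rewrite -image_comp; apply: subset_trans Ipsi; exact: image_subset.
Qed.

Definition QPZLBA : category :=
  concrete_category qpzlba_morphism_id qpzlba_morphism_comp.

Definition BoolC : category :=
  @concrete_category boolean_algebra (fun A => A)
    (fun A B phi => complete_boolean_hom phi)
    (fun A => complete_boolean_hom_id A)
    (fun A B C psi phi => @complete_boolean_hom_comp _ _ _ A B C psi phi).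

Record zlc_space := ZLCSpace {
  zlc_top :> topologicalType;
  zlc_zero_dim : zero_dim zlc_top;
  zlc_locally_compact : locally_compact [set: zlc_top];
  zlc_hausdorff : hausdorff_space zlc_top }.

Definition qpzlc_map (X Y : zlc_space) (f : X -> Y) : Prop :=
  quasi_open f /\ perfect_map f.

Lemma qpzlc_map_id (X : zlc_space) : qpzlc_map (@id X).
Proof. by split; [exact: quasi_open_id|exact: perfect_map_id]. Qed.

Lemma qpzlc_map_comp (X Y Z : zlc_space) (g : Y -> Z) (f : X -> Y) :
  qpzlc_map g -> qpzlc_map f -> qpzlc_map (g \o f).
Proof.
by move=> [? ?] [? ?]; split; [exact: quasi_open_comp|exact: perfect_map_comp].
Qed.

Definition QPZLC : category := concrete_category qpzlc_map_id qpzlc_map_comp.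

Record zhc_space := ZHCSpace {
  zhc_top :> topologicalType;
  zhc_zero_dim : zero_dim zhc_top;
  zhc_compact : compact [set: zhc_top];
  zhc_hausdorff : hausdorff_space zhc_top }.

Definition qzhc_map (X Y : zhc_space) (f : X -> Y) : Prop :=
  continuous f /\ quasi_open f.

Lemma qzhc_map_id (X : zhc_space) : qzhc_map (@id X).
Proof. by split; [move=> x; exact: cvg_id|exact: quasi_open_id]. Qed.

Lemma qzhc_map_comp (X Y Z : zhc_space) (g : Y -> Z) (f : X -> Y) :
  qzhc_map g -> qzhc_map f -> qzhc_map (g \o f).
Proof.
move=> [cg qg] [cf qf]; split; last exact: quasi_open_comp.
by move=> x; apply: continuous_comp; [exact: cf|exact: cg].
Qed.

Definition QZHC : category := concrete_category qzhc_map_id qzhc_map_comp.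

(* Main.v *)
From Pilot Require Import Defs.
Set Warnings "-notation-overridden,-notation-incompatible-prefix".
Set Warnings "-redundant-canonical-projection".
From HB Require Import structures.
From mathcomp Require Import all_boot all_order.
From mathcomp Require Import boolp classical_sets functions topology.

Set Implicit Arguments.
Unset Strict Implicit.
Unset Printing Implicit Defensive.

Import Order.Theory.
(* [fmap] is also an operation on filters; here the functorial one is meant. *)
Import Pilot.Defs.

Local Open Scope classical_set_scope.

(** Part (a) is a property of continuous closed maps between zero-dimensional
spaces ([quasi_open_complete]); a continuous map from a compact space to a
Hausdorff space is closed. The bridge is density: a clopen
set [G] is the join of a family of clopen sets exactly when the union of the
family is a dense subset of [G]. If [f] is quasi-open and the union of [S] is
dense in [G], then a non-empty open part of [f @^-1` G] missed by all the
[f @^-1` H], for [H] in [S], would have an image with non-empty interior inside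
[G], missed by all the [H]. Conversely, if [f] is not quasi-open, some non-empty
clopen [K] has a closed image with empty interior; the clopen sets disjoint
from [f @` K] have join [\top], whereas their inverse images lie in the
complement of [K].

For (b) and (c), the contravariant functor sends a space to its clopen algebra,
in (b) with the ideal of compact clopen sets, and a map to its inverse image
operator. A fully faithful and essentially surjective functor is an equivalence
([fully_faithful_equivalence]), so a functor in the other direction never has to
be built by hand.

Faithfulness holds because clopen sets separate points. For fullness, take a
homomorphism [phi : CO Y -> CO X] such that every [x] lies in [phi K] for some
compact [K]. By compactness, some [y] in [K] has the property that [x] lies in
[phi G] for all clopen [G] containing [y], and [x |-> y] is a continuous map with
inverse image operator [phi] ([boolean_hom_clopen_preimageP]). It is perfect when
[phi] maps compact sets to compact sets, and it is quasi-open by (a).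

Essential surjectivity is Stone's representation theorem for a ZLB-algebra
[(A, I)]. Its space consists of the ultrafilters of [A] that meet [I], with the
sets [stone_set a] as a base. Those with [a] in [I] are the compact ones, which
gives local compactness and allows [I] to be recovered. Density of [I] makes
[a |-> stone_set a] injective. A clopen set [U] determines the simple ideal of
all [a] in [I] with [stone_set a] included in [U], and the join of this ideal,
which is what the ZLB condition provides, is sent to [U] ([stone_map_surj]).
A Boolean algebra is a ZLB-algebra when all its elements are taken as the ideal,
and its space is then compact; (c) reuses the same representation in this
case. *)

(** * Equivalences of categories *)

(** The inverse functor chooses for each [d] an object [G0 d] with an isomorphism
[e d] from its image to [d], and sends a morphism to the lift of its conjugate
by [e]. All equations between lifts are checked after applying [F], which is
injective on morphisms. *)
Lemma fully_faithful_equivalence (C D : category) (F : functor C D) :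
  (forall a b : C, injective (@fmap C D F a b)) ->
  (forall (a b : C) (g : hom (F a) (F b)), exists f, fmap F f = g) ->
  (forall d : D, exists (c : C) (e : hom (F c) d), isomorphism e) ->
  equivalent C D.
Proof.
move=> faithful full esurj.
pose lift a b g := sval (cid (full a b g)).
have liftK a b g : fmap F (@lift a b g) = g by rewrite /lift; case: cid.
pose G0 d := sval (cid (esurj d)).
pose e d : hom (F (G0 d)) d := sval (cid (svalP (cid (esurj d)))).
have iso_e d : isomorphism (e d) := svalP (cid (svalP (cid (esurj d)))).
pose e' d := sval (cid (iso_e d)).
have e'K d : comp (e' d) (e d) = idm _ by rewrite /e'; case: cid => ? [].
have eK d : comp (e d) (e' d) = idm _ by rewrite /e'; case: cid => ? [].
pose Gmap d d' (g : hom d d') := lift _ _ (comp (e' d') (comp g (e d))).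
have Gmap1 d : Gmap _ _ (idm d) = idm (G0 d).
  by apply: faithful; rewrite liftK fmap1 comp1m.
have GmapM d1 d2 d3 (g : hom d2 d3) (f : hom d1 d2) :
    Gmap _ _ (comp g f) = comp (Gmap _ _ g) (Gmap _ _ f).
  apply: faithful; rewrite fmapM !liftK !compmA; congr comp.
  by rewrite -!compmA [comp (e d2) _]compmA eK comp1m.
exists F, (Functor Gmap1 GmapM); split.
  exists (fun a => lift _ _ (e (F a))); split=> [a|a b f] /=.
    exists (lift _ _ (e' (F a))).
    by split; apply: faithful; rewrite fmapM !liftK fmap1 /=.
  by apply: faithful; rewrite !fmapM !liftK !compmA eK comp1m.
exists e; split=> [d|d d' g] /=; first exact: iso_e.
by rewrite liftK compmA eK comp1m.
Qed.

(** * Clopen sets *)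

Section clopen_sets.
Context {X : topologicalType}.
Implicit Types (G H K : CO X) (U V : set X).

Definition CO_of U (cU : clopen U) : CO X := MkCO (introT (asboolP _) cU).

Lemma CO_clopen G : clopen G.
Proof. exact/asboolP/(co_subproof G). Qed.

Lemma CO_leP G H : (G <= H)%O <-> G `<=` H.
Proof. by rewrite -(subsetEset (G : set X)) -Order.le_val. Qed.

Lemma CO_complE G : (~` G)%O = ~` (G : set X) :> set X.
Proof. by []. Qed.

Lemma CO_joinE G H : (G `|` H)%O = (G : set X) `|` H :> set X.
Proof. by []. Qed.

Lemma CO_disjoint G H : (G `&` H)%O = \bot%O -> (G : set X) `&` H = set0.
Proof. by move=> /(congr1 (@co_set X)). Qed.

Lemma zero_dim_clopen : zero_dim X ->
  forall U x, nbhs x U -> exists2 G : CO X, co_set G x & G `<=` U.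
Proof.
by move=> [_ zX] U x /zX[V [cV Vx] VU]; exists (CO_of cV).
Qed.

Lemma compact_clopen_basis : zero_dim X -> locally_compact [set: X] ->
  forall U x, nbhs x U -> exists G : CO X, [/\ compact G, co_set G x & G `<=` U].
Proof.
move=> zX lX U x xU; have [C + [cC kC]] := lX x I.
rewrite /within/= => xC.
have [|G Gx GCU] := zero_dim_clopen zX (U := C `&` U) (x := x).
  by apply: filterI => //; apply: filterS xC => y; exact.
exists G; split=> //; last by move=> y /GCU[].
by apply: subclosed_compact cC _; [case: (CO_clopen G)|move=> y /GCU[]].
Qed.

Lemma clopen_separated : zero_dim X -> hausdorff_space X ->
  forall x y, (forall G, co_set G x -> co_set G y) -> x = y.
Proof.
move=> zX hX x y xy; apply: hX => U V xU yV.
have [G Gx GU] := zero_dim_clopen zX xU.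
by exists y; split; [exact/GU/xy|exact: nbhs_singleton].
Qed.

(** Otherwise the sets [K `\` U], for [U] in [B], would generate a proper filter
without cluster point in [K]. Asking [B] to be closed under finite unions gives
a single covering set, which is then an element of the algebra at hand instead
of a finite family. *)
Lemma compact_directed_cover (K : set X) (B : set (set X)) :
  compact K -> B set0 -> (forall U V, B U -> B V -> B (U `|` V)) ->
  (forall x, K x -> exists2 U, B U & nbhs x U) -> exists2 U, B U & K `<=` U.
Proof.
move=> cK B0 BU covK; apply: contrapT => nK.
pose F := filter_from B (fun U => K `\` U).
have FF : ProperFilter F.
  apply: filter_from_proper.
    apply: filter_from_filter; first by exists set0.
    by move=> U V BU' BV; exists (U `|` V); [exact: BU|rewrite setDUr].
  move=> U BU'; apply/set0P/negP => /eqP/subsets_disjoint KU.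
  by apply: nK; exists U => //; move: KU; rewrite setCK.
have [|x [Kx Fx]] := cK F FF; first by exists set0; rewrite ?setD0.
have [U BU' xU] := covK x Kx.
have [|y [[_ nUy] Uy]//] := Fx (K `\` U) U _ xU.
by exists U.
Qed.

(** A clopen subset of [V] missed by all members of [S] could be removed from
[G], leaving a smaller upper bound. *)
Lemma supremum_dense : zero_dim X -> forall (S : set (CO X)) G V,
  supremums S G -> open V -> V !=set0 -> V `<=` G ->
  exists2 H, S H & H `&` V !=set0.
Proof.
move=> zX S G V [_ Gleast] oV [x Vx] VG; apply: contrapT => nS.
have [W Wx WV] := zero_dim_clopen zX (open_nbhs_nbhs (conj oV Vx)).
have /CO_leP/(_ x (VG x Vx)) : (G <= ~` W)%O; last by rewrite CO_complE.
  apply: Gleast => H SH; apply/CO_leP => y Hy; rewrite CO_complE => Wy.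
  by apply: nS; exists H => //; exists y; split=> //; exact: WV.
Qed.

End clopen_sets.

(** * Quasi-open maps and complete homomorphisms *)

(** For such a map, quasi-openness means that inverse images of dense open sets
are dense; completeness says this relative to clopen sets [G]. *)
Lemma quasi_open_complete (X Y : topologicalType) (f : X -> Y)
    (cf : continuous f) :
  zero_dim X -> zero_dim Y -> (forall A : set X, closed A -> closed (f @` A)) ->
  quasi_open f <-> complete_boolean_hom (clopen_preimage cf).
Proof.
move=> zX zY clf; split=> [qf|[_ jf] U oU [x Ux]].
  split=> [|S G SG]; first exact: clopen_preimage_boolean_hom.
  split=> [_ [H SH <-]|U Uub].
    by apply/CO_leP => x; apply: (CO_leP H G).1; exact: SG.1.
  apply/CO_leP => x Gx; apply: contrapT => nUx.
  pose V := f @^-1` G `\` U.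
  have oV : open V.
    rewrite /V setDE; apply: openI; last first.
      by apply: closed_openC; case: (CO_clopen U).
    by have [] := CO_clopen (clopen_preimage cf G).
  have [y Vy] : (f @` V)° !=set0 by apply: qf => //; exists x.
  have VG : (f @` V)° `<=` G by move=> _ /interior_subset[z [Gz _] <-].
  have [|H SH [z [Hz /interior_subset[t [_ nUt] ft]]]] :=
    supremum_dense zY SG (@open_interior _ (f @` V)) _ VG; first by exists y.
  apply: nUt; have /CO_leP : (clopen_preimage cf H <= U)%O.
    by apply: Uub; exists H.
  by apply; rewrite /= /preimage ft.
have [K Kx KU] := zero_dim_clopen zX (open_nbhs_nbhs (conj oU Ux)).
apply: contrapT => nfU.
have cfK : closed (f @` K) by apply: clf; case: (CO_clopen K).
pose S := [set H : CO Y | H `&` f @` K = set0].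
(* The complement of a clopen upper bound [G] of [S] is an open set contained
   in [f @` K], hence it is empty. *)
have ST : supremums S \top%O.
  split; first by move=> H _; exact: lex1.
  move=> G Gub; apply/CO_leP => y _; apply: contrapT => nGy.
  apply: nfU; exists y; rewrite /interior/= nbhsE; exists (~` G).
    by split=> //; apply: closed_openC; case: (CO_clopen G).
  move=> z nGz; apply: contrapT => nfUz.
  have [|H Hz HfK] := zero_dim_clopen zY (U := ~` (f @` K)) (x := z).
    apply: open_nbhs_nbhs; split; first exact: closed_openC.
    by move=> [t Kt ft]; apply: nfUz; exists t => //; exact: KU.
  apply: nGz; have /CO_leP : (H <= G)%O; last by apply.
  by apply: Gub; apply/disjoints_subset.
have /CO_leP/(_ x I) : (clopen_preimage cf \top <= ~` K)%O; last exact.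
apply: (jf _ _ ST).2 => _ [H SH <-]; apply/CO_leP => t Ht.
rewrite CO_complE => Kt; suff : (H `&` f @` K) (f t) by rewrite SH.
by split=> //; exists t.
Qed.

(** * Continuous maps and homomorphisms of clopen algebras *)

(** Closedness of the image of [A] is local on [Y]: near [y] that image agrees
with the image of the compact set [A `&` f @^-1` K]. *)
Lemma perfect_of_compact_preimages (X Y : topologicalType) (f : X -> Y) :
  hausdorff_space Y -> continuous f ->
  (forall y : Y, exists2 K, nbhs y K & compact (f @^-1` K)) -> perfect_map f.
Proof.
move=> hY cf pK; split=> // [A cA y clAy|y].
  have [K yK cK] := pK y.
  have : closed (f @` (A `&` f @^-1` K)).
    apply: compact_closed => //; apply: continuous_compact.
      exact: continuous_subspaceT.
    by rewrite setIC; exact: compact_closedI.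
  move=> /(_ y) []; last by move=> x [Ax _] <-; exists x.
  move=> V yV; have [_ [[x Ax <-] [Kx Vx]]] := clAy (K `&` V) (filterI yK yV).
  by exists (f x); split=> //; exists x.
have [K yK cK] := pK y.
apply: subclosed_compact cK _; last first.
  by move=> x /= ->; exact: nbhs_singleton yK.
apply: preimage_closed => //.
by apply: compact_closed => //; exact: compact_set1.
Qed.

(** The value [f x] is a point all of whose clopen neighbourhoods [G] satisfy
[x \in phi G]. If no point of [K] had this property, finitely many clopen sets
[G] with [x] outside [phi G] would cover [K], putting [x] outside [phi K]. The
inclusion [f @^-1` G `<=` phi G] obtained this way becomes an equality by
applying it to the complement of [G]. *)
Lemma boolean_hom_clopen_preimageP (X Y : topologicalType) (phi : CO Y -> CO X) :
  zero_dim Y -> boolean_hom phi ->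
  (forall x, exists2 K : CO Y, compact K & co_set (phi K) x) ->
  exists (f : X -> Y) (cf : continuous f), clopen_preimage cf = phi.
Proof.
move=> zY bphi bounded.
have /choice[f fP] : forall x, exists y, forall G, co_set G y -> co_set (phi G) x.
  move=> x; have [K cK phiKx] := bounded x.
  pose B : set (set Y) :=
    [set U | exists2 G : CO Y, U = co_set G & ~ co_set (phi G) x].
  apply: contrapT => noy.
  have [||y Ky|_ [G -> nphiGx] KG] := @compact_directed_cover _ K B cK.
  - by exists \bot%O => //; rewrite (boolean_hom0 bphi).
  - move=> _ _ [G -> nG] [H -> nH]; exists (G `|` H)%O => //.
    by rewrite (boolean_homU bphi) => -[].
  - move/forallNP : noy => /(_ y)/existsNP[G /not_implyP[Gy nphiGx]].
    exists G; first by exists G.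
    by apply: open_nbhs_nbhs; split=> //; case: (CO_clopen G).
  - move: KG => /CO_leP; rewrite leEmeet => /eqP KG; apply: nphiGx.
    suff /CO_leP/(_ x phiKx) : (phi K <= phi G)%O by [].
    by rewrite leEmeet -(boolean_homI bphi) KG.
have fE (G : CO Y) : f @^-1` G = phi G.
  apply/seteqP; split=> x /=; first exact: fP.
  move=> phiGx; apply: contrapT => nGfx; have := fP x (~` G)%O nGfx.
  by rewrite (boolean_homC bphi) CO_complE; exact.
have cf : continuous f.
  move=> x V fxV; have [G Gfx GV] := zero_dim_clopen zY fxV.
  suff : nbhs x (f @^-1` G) by apply: filterS => z /GV.
  apply: open_nbhs_nbhs; split; last exact: Gfx.
  by rewrite fE; case: (CO_clopen (phi G)).
by exists f, cf; apply/funext => G; apply: val_inj; exact: fE.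
Qed.

Lemma clopen_preimage_inj (X Y : topologicalType) (f g : X -> Y)
    (cf : continuous f) (cg : continuous g) :
  zero_dim Y -> hausdorff_space Y ->
  clopen_preimage cf = clopen_preimage cg -> f = g.
Proof.
move=> zY hY fg; apply/funext => x; apply: clopen_separated => // G.
by move: fg => /(congr1 (fun h => co_set (h G) x)) /= ->.
Qed.

(** * Simple ideals *)

Section simple_ideals.
Context {d : Order.disp_t} {L : bDistrLatticeType d}.
Implicit Types J K : set L.

Lemma ideal_neg_ideal J : is_ideal (ideal_neg J).
Proof.
split=> [b _|a b ab nJb c Jc|a b nJa nJb c Jc]; first exact: meet0x.
  by apply/le_anti; rewrite le0x andbT -(nJb c Jc) leI2.
by rewrite meetUl nJa// nJb// joinx0.
Qed.

Lemma ideal_joinP J K t : is_ideal J -> is_ideal K -> ideal_join J K t ->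
  exists a b, [/\ J a, K b & (t <= a `|` b)%O].
Proof.
move=> iJ iK; pose D := [set c | exists a b, [/\ J a, K b & (c <= a `|` b)%O]].
move=> /(_ D); apply; split; last first.
  move=> c [Jc|Kc].
    by exists c, \bot%O; split=> //; [exact: ideal0|rewrite joinx0].
  by exists \bot%O, c; split=> //; [exact: ideal0|rewrite join0x].
split.
- by exists \bot%O, \bot%O; split; [exact: ideal0|exact: ideal0|exact: le0x].
- move=> c c' cc' [a [b [Ja Kb c'ab]]]; exists a, b; split=> //.
  exact: le_trans c'ab.
- move=> c c' [a [b [Ja Kb cab]]] [a' [b' [Ja' Kb' cab']]].
  exists (a `|` a')%O, (b `|` b')%O; split; [exact: idealU|exact: idealU|].
  by rewrite joinACA leU2.
Qed.

Lemma simple_ideal_split J t : simple_ideal J ->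
  exists a b, [/\ J a, ideal_neg J b & (t <= a `|` b)%O].
Proof.
move=> [iJ JT]; apply: ideal_joinP => //; first exact: ideal_neg_ideal.
by rewrite JT.
Qed.

End simple_ideals.

Definition ideal_elt_of d (L : bDistrLatticeType d) (J : ideal L) a
  (Ja : ideal_set J a) : ideal_elt J := IdealElt (introT (asboolP _) Ja).

Lemma ideal_elt_leE d (L : bDistrLatticeType d) (J : ideal L)
    (a b : ideal_elt J) :
  (a <= b)%O = (ideal_val a <= ideal_val b)%O.
Proof. by rewrite -Order.le_val. Qed.

Lemma ideal_valU d (L : bDistrLatticeType d) (J : ideal L) (a b : ideal_elt J) :
  ideal_val (a `|` b)%O = (ideal_val a `|` ideal_val b)%O.
Proof. by []. Qed.

Lemma ideal_elt_disjoint d (L : bDistrLatticeType d) (J : ideal L)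
    (a b : ideal_elt J) :
  (a `&` b)%O = \bot%O -> (ideal_val a `&` ideal_val b)%O = \bot%O.
Proof. by move=> /(congr1 (@ideal_val _ _ J)). Qed.

(** * The space of bounded ultrafilters *)

(** Compatibility with meets and complements already makes [ultra_set] a proper
prime filter. Requiring it to meet the ideal is what replaces compactness of the
Stone space by local compactness. *)
Record bounded_ultrafilter (A : local_boolean_algebra) := BoundedUltrafilter {
  ultra_set : set A;
  ultraI : forall a b, ultra_set (a `&` b)%O <-> ultra_set a /\ ultra_set b;
  ultraC : forall a, ultra_set (~` a)%O <-> ~ ultra_set a;
  ultra_bounded : exists2 a, ideal_set (lba_ideal A) a & ultra_set a }.

HB.instance Definition _ A := gen_eqMixin (bounded_ultrafilter A).
HB.instance Definition _ A := gen_choiceMixin (bounded_ultrafilter A).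

Section bounded_ultrafilters.
Context {A : local_boolean_algebra}.
Local Notation I := (ideal_set (lba_ideal A)).
Local Notation X := (bounded_ultrafilter A).
Implicit Types (a b c : A) (u v : X) (U V : set X).

Lemma ultra_le u a b : (a <= b)%O -> ultra_set u a -> ultra_set u b.
Proof. by rewrite leEmeet => /eqP {1}<- /ultraI[]. Qed.

Lemma ultra0 u : ~ ultra_set u \bot%O.
Proof. by move=> u0; have /ultraC := ultra_le (le0x (~` \bot)%O) u0. Qed.

Lemma ultra_inj u v : ultra_set u = ultra_set v -> u = v.
Proof.
case: u v => [u u1 u2 u3] [v v1 v2 v3] /= uv; subst v.
by congr BoundedUltrafilter; exact: Prop_irrelevance.
Qed.

Definition stone_set a : set X := [set u | ultra_set u a].

Lemma stone_setI a b : stone_set (a `&` b)%O = stone_set a `&` stone_set b.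
Proof. by apply/seteqP; split=> u /ultraI. Qed.

Lemma stone_setC a : stone_set (~` a)%O = ~` stone_set a.
Proof. by apply/seteqP; split=> u /ultraC. Qed.

Lemma stone_set0 : stone_set \bot%O = set0.
Proof. by apply/seteqP; split=> // u /ultra0. Qed.

Lemma stone_set1 : stone_set \top%O = setT.
Proof. by rewrite -compl0 stone_setC stone_set0 setC0. Qed.

Lemma stone_setU a b : stone_set (a `|` b)%O = stone_set a `|` stone_set b.
Proof.
apply: setC_inj.
by rewrite setCU -!stone_setC -stone_setI complU.
Qed.

Lemma stone_setS a b : (a <= b)%O -> stone_set a `<=` stone_set b.
Proof. by move=> ab u; exact: ultra_le. Qed.

Definition stone_open U :=
  forall u, U u -> exists2 a, ultra_set u a & stone_set a `<=` U.

Let stone_openT : stone_open setT.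
Proof. by move=> u _; have [a _ ua] := ultra_bounded u; exists a. Qed.

Let stone_openI : setI_closed stone_open.
Proof.
move=> U V oU oV u [/oU[a ua aU] /oV[b ub bV]].
exists (a `&` b)%O; first exact/ultraI.
by rewrite stone_setI; exact: setISS.
Qed.

Let stone_open_bigU (J : Type) (f : J -> set X) :
  (forall i, stone_open (f i)) -> stone_open (\bigcup_i f i).
Proof.
move=> of_ u [i _ /of_[a ua af]]; exists a => // v /af fiv.
by exists i.
Qed.

HB.instance Definition _ := isOpenTopological.Build X
  stone_openT stone_openI stone_open_bigU.

Lemma stone_nbhsP u U :
  nbhs u U <-> exists2 a, ultra_set u a & stone_set a `<=` U.
Proof.
split=> [[V [oV Vu VU]]|[a ua aU]].
  by have [a ua aV] := oV u Vu; exists a => //; exact: subset_trans VU.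
by exists (stone_set a); split=> // v va; exists a.
Qed.

Lemma stone_clopen a : clopen (stone_set a).
Proof.
have os b : open (stone_set b).
  by rewrite openE => u ub; apply/stone_nbhsP; exists b.
by split=> //; rewrite -[a]complK stone_setC; exact: open_closedC.
Qed.

Lemma stone_zero_dim : zero_dim X.
Proof.
split=> [U []//|u U /stone_nbhsP[a ua aU]].
by exists (stone_set a) => //; split=> //; exact: stone_clopen.
Qed.

Lemma stone_hausdorff : hausdorff_space X.
Proof.
move=> u v uv; apply: ultra_inj.
have sub a : ultra_set u a -> ultra_set v a.
  move=> ua; apply: contrapT => /ultraC va.
  have [w []] : stone_set a `&` stone_set (~` a)%O !=set0.
    by apply: uv; apply/stone_nbhsP; [exists a|exists (~` a)%O].
  by move=> wa /ultraC.
apply/seteqP; split=> // a va; apply: contrapT => /ultraC/sub/ultraC.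
exact.
Qed.

(** Ultrafilters of [A] are obtained from ultrafilters of sets along a map that
respects meets and, up to [F], complements. With [h := stone_set] this gives
limits in the space, with [h b] the non-zero elements below [b] it gives enough
points. *)
Lemma ultrafilter_pullback T (F : set_system T) (h : A -> set T) :
  UltraFilter F -> (forall a b, h (a `&` b)%O = h a `&` h b) ->
  ~ F (h \bot%O) -> (forall a, F (h a `|` h (~` a)%O)) ->
  (exists2 a, I a & F (h a)) ->
  exists u, forall a, ultra_set u a <-> F (h a).
Proof.
move=> UF hI h0 hC hb; pose U := [set a | F (h a)].
have UI a b : U (a `&` b)%O <-> U a /\ U b.
  rewrite /U/= hI; split=> [Fab|[]]; last exact: filterI.
  by split; apply: filterS Fab => t [].
have UC a : U (~` a)%O <-> ~ U a.
  split=> [Uca Ua|nUa].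
    by apply: h0; rewrite -(meetxC a) hI; exact: filterI.
  have [//|Fnha] := in_ultra_setVsetC (h a) UF.
  by apply: filterS (filterI (hC a) Fnha) => t [[]].
by exists (BoundedUltrafilter UI UC hb).
Qed.

(** An ultrafilter [F] of sets containing [stone_set a] converges to the ultrafilter
of all [b] with [stone_set b] in [F], which is bounded because it contains
[a]. *)
Lemma stone_compact a : I a -> compact (stone_set a).
Proof.
move=> Ia; rewrite compact_ultra => F UF Fa.
have [u uE] : exists u, forall b, ultra_set u b <-> F (stone_set b).
  apply: ultrafilter_pullback => //; first exact: stone_setI.
  - by rewrite stone_set0; exact: filter_not_empty.
  - by move=> b; rewrite stone_setC setUCr; exact: filterT.
  - by exists a.
exists u; split; first exact/uE.
by move=> U /stone_nbhsP[b /uE Fb bU]; exact: filterS Fb.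
Qed.

Lemma stone_locally_compact : locally_compact [set: X].
Proof.
move=> u _; have [a Ia ua] := ultra_bounded u.
exists (stone_set a).
  by apply/stone_nbhsP; exists a.
by split; [exact: stone_compact|case: (stone_clopen a)].
Qed.

(** Say that a non-zero [t] decides [c] if it lies below [c] or below its
complement. Some non-zero element below [a] decides any given finite list, since
one of the meets with [c] and with its complement stays non-zero. So the sets
[D s] generate a proper filter on [A]; an ultrafilter of sets extending it
selects, for every [c], either the elements below [c] or those below its
complement. *)
Lemma ultrafilter_exists a : I a -> a != \bot%O -> stone_set a !=set0.
Proof.
move=> Ia a0; pose decides c t := (t <= c)%O \/ (t <= ~` c)%O.
pose D (s : seq A) :=
  [set t | [/\ t != \bot%O, (t <= a)%O & {in s, forall c, decides c t}]].
have D0 s : D s !=set0.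
  elim: s => [|c s [t [t0 ta ts]]]; first by exists a; split.
  have below t' : (t' <= t)%O -> t' != \bot%O -> decides c t' -> D (c :: s) t'.
    move=> t't t'0 ct'; split=> //; first exact: le_trans ta.
    move=> b; rewrite inE => /predU1P[->//|/ts[tb|tb]].
      by left; exact: le_trans tb.
    by right; exact: le_trans tb.
  have [tc0|tc0] := eqVneq (t `&` c)%O \bot%O.
    exists t; apply: below => //; right.
    by rewrite leEmeet -[X in X == _]joinx0 -tc0 -meetUr joinCx meetx1.
  by exists (t `&` c)%O; apply: below; rewrite ?leIl//; left; exact: leIr.
have FD : ProperFilter (filter_from setT D).
  apply: filter_from_proper => //; apply: filter_from_filter.
    by exists [::].
  move=> s s' _ _; exists (s ++ s') => // t [t0 ta ts].
  by split; split=> // c cs; apply: ts; rewrite mem_cat cs ?orbT.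
have [F [UF DF]] := ultraFilterLemma FD.
pose h b := [set t : A | t != \bot%O /\ (t <= b)%O].
have [u uE] : exists u, forall b, ultra_set u b <-> F (h b).
  apply: ultrafilter_pullback => // [b c||b|].
  - apply/seteqP; split=> t; rewrite /h/= lexI.
      by move=> [t0 /andP[tb tc]].
    by move=> [[t0 tb] [_ tc]]; split=> //; apply/andP.
  - rewrite (_ : h _ = set0); first exact: filter_not_empty.
    by apply/seteqP; split=> // t [/negP]; rewrite lex0.
  - apply: DF; exists [:: b] => // t [t0 _ /(_ b)].
    by rewrite mem_head => /(_ isT)[]; [left|right].
  - by exists a => //; apply: DF; exists [::] => // t [].
by exists u; apply/uE; apply: DF; exists [::] => // t [].
Qed.

Lemma stone_set_eq0 a : stone_set a = set0 -> a = \bot%O.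
Proof.
move=> sa0; apply: contrapT => /eqP /(@lba_dense A)[b [Ib b0 ba]].
have [u ub] := ultrafilter_exists Ib b0.
by have := stone_setS ba ub; rewrite sa0.
Qed.

Lemma stone_set_subset a b : stone_set a `<=` stone_set b -> (a <= b)%O.
Proof.
move=> ab; have /stone_set_eq0 abC0 : stone_set (a `&` ~` b)%O = set0.
  by by rewrite stone_setI stone_setC -setDE setD_eq0.
by rewrite leEmeet -[X in X == _]joinx0 -abC0 -meetUr joinxC meetx1.
Qed.

(** A compact [stone_set a] is covered by the sets [stone_set b] with [b] in the
ideal, hence lies in one of them, so that [a <= b]. *)
Lemma stone_set_compactP a : compact (stone_set a) <-> I a.
Proof.
split; last exact: stone_compact.
have iI := idealP (lba_ideal A).
pose B : set (set X) := [set U | exists2 b, I b & U = stone_set b].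
move=> ca; have [||u ua|_ [b Ib ->] ab] := @compact_directed_cover _ _ B ca.
- by exists \bot%O; rewrite ?stone_set0//; exact: ideal0.
- move=> _ _ [b Ib ->] [c Ic ->]; exists (b `|` c)%O; first exact: idealU.
  by rewrite stone_setU.
- have [b Ib ub] := ultra_bounded u; exists (stone_set b); first by exists b.
  by apply/stone_nbhsP; exists b.
- exact: ideal_le iI _ _ (stone_set_subset ab) Ib.
Qed.

(** Within the compact set [stone_set a], the clopen set [U] is a union of finitely
many basic sets. *)
Lemma stone_clopen_approx (U : CO X) a : I a ->
  exists c, [/\ I c, stone_set c `<=` U & stone_set a `&` U `<=` stone_set c].
Proof.
move=> Ia; have iI := idealP (lba_ideal A).
pose B : set (set X) :=
  [set V | exists c, [/\ I c, stone_set c `<=` U & V = stone_set c]].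
have caU : compact (stone_set a `&` U).
  by apply: compact_closedI; [exact: stone_compact|case: (CO_clopen U)].
have [||u [ua Uu]|_ [c [Ic cU ->]] aUc] := @compact_directed_cover _ _ B caU.
- exists \bot%O; rewrite stone_set0; split=> //; exact: ideal0.
- move=> _ _ [b [Ib bU ->]] [c [Ic cU ->]]; exists (b `|` c)%O.
  by rewrite stone_setU subUset; split=> //; exact: idealU.
- have [oU _] := CO_clopen U.
  have /stone_nbhsP[b ub bU] : nbhs u U by exact: open_nbhs_nbhs.
  exists (stone_set (a `&` b)%O); last first.
    by apply/stone_nbhsP; exists (a `&` b)%O => //; apply/ultraI.
  exists (a `&` b)%O; split=> //; first exact: ideal_le iI _ _ (leIl a b) Ia.
  by rewrite stone_setI => v [_ /bU].
- by exists c.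
Qed.

End bounded_ultrafilters.

Definition stone_map (A : local_boolean_algebra) (a : A) :
    CO (bounded_ultrafilter A) :=
  CO_of (stone_clopen a).

Lemma stone_map_boolean_hom (A : local_boolean_algebra) :
  boolean_hom (@stone_map A).
Proof.
split=> [||a b|a b|a]; apply: val_inj.
- exact: stone_set0.
- exact: stone_set1.
- exact: stone_setI.
- exact: stone_setU.
- exact: stone_setC.
Qed.

Lemma stone_map_inj (A : local_boolean_algebra) : injective (@stone_map A).
Proof.
move=> a b /(congr1 (@co_set _)) ab; apply/le_anti.
by apply/andP; split; apply: stone_set_subset; move: ab => /= ->.
Qed.

(** The elements of the ideal whose basic set lies in [U] form an ideal [J], which
is simple because [stone_clopen_approx] splits every element of the ideal into a
part in [J] and a part disjoint from [J]. Its join [m] represents [U]: a point of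
[stone_set m] outside [U] would lie in some [stone_set c] disjoint from [U], but
then the complement of [c] bounds [J] and hence [m]. *)
Lemma stone_map_surj (A : zlb_algebra) (U : CO (bounded_ultrafilter A)) :
  exists a, stone_map a = U.
Proof.
pose J := [set c : ideal_elt (lba_ideal A) | stone_set (ideal_val c) `<=` U].
have sJ : simple_ideal J.
  split.
    split=> [|a b ab|a b Ja Jb]; rewrite /J/=.
    - by rewrite stone_set0.
    - by apply: subset_trans; apply: stone_setS; exact: ab.
    - by rewrite stone_setU subUset.
  apply/seteqP; split=> // a _ K [iK JK].
  have Ia : ideal_set (lba_ideal A) (ideal_val a).
    exact/asboolP/ideal_elt_subproof.
  have [c [Ic cU aUc]] := stone_clopen_approx U Ia.
  have Ir : ideal_set (lba_ideal A) (ideal_val a `&` ~` c)%O.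
    by apply: (ideal_le (idealP (lba_ideal A))) Ia; exact: leIl.
  pose c' := ideal_elt_of Ic; pose r := ideal_elt_of Ir.
  have -> : a = ((a `&` c') `|` r)%O.
    by apply: val_inj; rewrite /= -[RHS]meetUr joinxC meetx1.
  apply: (idealU iK); apply: JK; [left|right].
    by apply: subset_trans cU; apply: stone_setS; exact: leIr.
  move=> e Je; apply: val_inj; apply: stone_set_eq0.
  apply/seteqP; split=> // u /ultraI[/ultraI[ua /ultraC nuc] /Je Uu].
  by apply: nuc; exact: aUc.
have [m [mub mlub]] := zlbaP sJ.
exists m; apply: val_inj; apply/seteqP; split=> u /=; last first.
  move=> Uu; have [a Ia ua] := ultra_bounded u.
  have [c [Ic cU aUc]] := stone_clopen_approx U Ia.
  apply: ultra_le (aUc _ (conj ua Uu)).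
  by apply: mub; exists (ideal_elt_of Ic).
move=> um; apply: contrapT => nUu; have [a Ia ua] := ultra_bounded u.
have [c [Ic cU aUc]] := stone_clopen_approx (~` U)%O Ia.
have /ultraC : ultra_set u (~` c)%O.
  apply: ultra_le um; apply: mlub => _ [e Je <-].
  apply: stone_set_subset; rewrite stone_setC => v /Je Uv /cU.
  exact.
by apply; exact: aUc.
Qed.

(** * Isomorphisms of ZLB-algebras *)

Section boolean_isomorphisms.
Context {d d' : Order.disp_t}.
Context {A : ctbDistrLatticeType d} {B : ctbDistrLatticeType d'}.
Variables (phi : A -> B) (psi : B -> A).
Hypotheses (bphi : boolean_hom phi).
Hypotheses (phiK : cancel phi psi) (psiK : cancel psi phi).

Lemma boolean_hom_inverse : boolean_hom psi.
Proof.
have phi_inj := can_inj phiK.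
split=> [||a b|a b|a]; apply: phi_inj; rewrite psiK.
- by rewrite (boolean_hom0 bphi).
- by rewrite (boolean_hom1 bphi).
- by rewrite (boolean_homI bphi) !psiK.
- by rewrite (boolean_homU bphi) !psiK.
- by rewrite (boolean_homC bphi) !psiK.
Qed.

Lemma boolean_iso_complete : complete_boolean_hom phi.
Proof.
have phi_le a b : (phi a <= phi b)%O = (a <= b)%O.
  by rewrite !leEmeet -(boolean_homI bphi) (can_eq phiK).
split=> // S a [aub alub]; split=> [_ [b Sb <-]|c cub].
  by rewrite phi_le; exact: aub.
rewrite -[c]psiK phi_le; apply: alub => b Sb.
by rewrite -phi_le psiK; apply: cub; exists b.
Qed.

End boolean_isomorphisms.

Lemma qpzlba_isomorphism (A B : zlb_algebra) (phi : A -> B) (psi : B -> A) :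
  boolean_hom phi -> cancel phi psi -> cancel psi phi ->
  (forall a, ideal_set (lba_ideal B) (phi a) <-> ideal_set (lba_ideal A) a) ->
  qpzlba_morphism phi.
Proof.
move=> bphi phiK psiK Iphi; split.
- split=> // b Ib; exists (psi b); last by rewrite psiK.
  by apply/Iphi; rewrite psiK.
- by move=> _ [a Ia <-]; exact/Iphi.
- exact: boolean_iso_complete phiK psiK.
Qed.

(** * The ZLB-algebra of a locally compact space *)

Section compact_clopens.
Variable X : topologicalType.

Lemma compact_clopens_ideal : is_ideal [set K : CO X | compact K].
Proof.
split=> [|G K /CO_leP GK cK|K L cK cL] /=.
- exact: compact0.
- by apply: subclosed_compact cK GK; case: (CO_clopen G).
- exact: compactU.
Qed.

Definition compact_clopens : ideal (CO X) := Ideal compact_clopens_ideal.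

End compact_clopens.

Section clopen_algebra.
Variable X : zlc_space.

Lemma compact_clopen_exists (x : X) : exists2 K : CO X, compact K & co_set K x.
Proof.
have [K [cK Kx _]] := compact_clopen_basis (@zlc_zero_dim X)
  (@zlc_locally_compact X) (@filterT _ _ (nbhs_filter x)).
by exists K.
Qed.

Lemma compact_clopens_dense : dense_ideal (compact_clopens X).
Proof.
move=> G /eqP G0; have [x Gx] : (G : set X) !=set0.
  by apply/set0P/eqP => ?; apply: G0; exact: val_inj.
have [K [cK Kx KG]] := compact_clopen_basis (@zlc_zero_dim X)
  (@zlc_locally_compact X) (open_nbhs_nbhs (conj (CO_clopen G).1 Gx)).
exists K; split=> //; last exact/CO_leP.
by apply/eqP => K0; move: Kx; rewrite K0.
Qed.

Definition clopen_lba : local_boolean_algebra :=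
  @LocalBooleanAlgebra (BooleanAlgebra (CO X)) (compact_clopens X)
    compact_clopens_dense.

Local Notation elt := (ideal_elt (compact_clopens X)).

(** The join is the union [U]. If [x] is not in [U], simplicity covers a compact
clopen neighbourhood of [x] by some [G] in [J] and some [H] disjoint from all
members of [J]; then [H] is a neighbourhood of [x] disjoint from [U], so [U] is
closed. *)
Lemma simple_ideal_supremum (J : set elt) :
  simple_ideal J -> exists U, supremums (@ideal_val _ _ _ @` J) U.
Proof.
move=> sJ; pose U : set X := \bigcup_(K in J) co_set (ideal_val K).
have oU : open U.
  by apply: bigcup_open => K _; case: (CO_clopen (ideal_val K)).
have cU : clopen U.
  split=> //; rewrite -[U]setCK; apply: open_closedC.
  rewrite openE => x nUx.
  have [K cK Kx] := compact_clopen_exists x.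
  have [G [H [JG JH]]] := simple_ideal_split
    (@ideal_elt_of _ _ (compact_clopens X) K cK) sJ.
  rewrite ideal_elt_leE ideal_valU => /CO_leP/(_ x Kx); rewrite CO_joinE => GHx.
  rewrite /interior/= nbhsE; exists (co_set (ideal_val H)).
    split; first by case: (CO_clopen (ideal_val H)).
    by case: GHx => // Gx; case: nUx; exists G.
  move=> y Hy [L JL Ly].
  have := CO_disjoint (ideal_elt_disjoint (JH L JL)).
  by move=> /seteqP[/(_ y)] + _; apply.
exists (CO_of cU); split=> [_ [K JK <-]|V Vub].
  by apply/CO_leP => x Kx; exists K.
apply/CO_leP => x [K JK Kx]; move: x Kx; apply/CO_leP.
by apply: Vub; exists K.
Qed.

Lemma clopen_zlba : is_zlba clopen_lba.
Proof. exact: simple_ideal_supremum. Qed.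

Definition clopen_zlb_algebra : zlb_algebra := ZLBAlgebra clopen_zlba.

End clopen_algebra.

(** * The duality for locally compact spaces *)

(** The image of a compact clopen set under [f] is compact, hence contained in a
compact clopen set. *)
Lemma clopen_preimage_qpzlba (X Y : zlc_space) (f : X -> Y) (cf : continuous f) :
  qpzlc_map f ->
  @qpzlba_morphism (clopen_zlb_algebra Y) (clopen_zlb_algebra X)
    (clopen_preimage cf).
Proof.
move=> [qf pf]; split.
- split; first exact: clopen_preimage_boolean_hom.
  move=> K cK; pose B : set (set Y) :=
    [set U | exists2 G : CO Y, compact G & U = co_set G].
  have cfK : compact (f @` co_set K).
    by apply: continuous_compact => //; exact: continuous_subspaceT.
  have [||y _|_ [G cG ->] KG] := @compact_directed_cover _ _ B cfK.
  + by exists \bot%O => //; exact: compact0.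
  + by move=> _ _ [G cG ->] [H cH ->]; exists (G `|` H)%O => //; exact: compactU.
  + have [G cG Gy] := compact_clopen_exists y.
    exists G; first by exists G.
    by apply: open_nbhs_nbhs; split=> //; case: (CO_clopen G).
  + by exists G => //; apply/CO_leP => x Kx; apply: KG; exists x.
- by move=> _ [K cK <-]; exact: perfect_preimage_compact.
- apply/quasi_open_complete => //; [exact: zlc_zero_dim..|].
  exact: perfect_closed.
Qed.

Section clopen_functor.

Let clopen_map (X Y : QPZLC) (f : hom X Y) :
    @hom (opposite QPZLBA) (clopen_zlb_algebra X) (clopen_zlb_algebra Y) :=
  exist _ _ (clopen_preimage_qpzlba (perfect_continuous (svalP f).2) (svalP f)).

Let clopen_map1 (X : QPZLC) : clopen_map (idm X) = idm _.
Proof. by apply: eq_exist; apply/funext => G; exact: val_inj. Qed.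

Let clopen_mapM (X Y Z : QPZLC) (g : hom Y Z) (f : hom X Y) :
  clopen_map (comp g f) = comp (clopen_map g) (clopen_map f).
Proof. by apply: eq_exist; apply/funext => G; exact: val_inj. Qed.

Definition clopen_functor : functor QPZLC (opposite QPZLBA) :=
  Functor clopen_map1 clopen_mapM.

End clopen_functor.

Lemma clopen_functor_faithful (X Y : QPZLC) :
  injective (@fmap _ _ clopen_functor X Y).
Proof.
move=> [f fP] [g gP] /(congr1 sval) fg; apply: eq_exist.
exact: clopen_preimage_inj (@zlc_zero_dim Y) (@zlc_hausdorff Y) fg.
Qed.

(** The condition that [phi] is cofinal in the target ideal supplies the compact sets
needed to define [f]; the condition that [phi] maps ideal to ideal makes the
inverse images of compact clopen sets compact, so [f] is perfect. *)
Lemma clopen_functor_full (X Y : QPZLC)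
    (phi : hom (clopen_functor X) (clopen_functor Y)) :
  exists f, fmap clopen_functor f = phi.
Proof.
case: phi => phi phiP; have [[bphi bounded] compact_phi cphi] := phiP.
have [x|f [cf fE]] := boolean_hom_clopen_preimageP (@zlc_zero_dim Y) bphi.
  have [K cK Kx] := compact_clopen_exists x.
  have [G cG /CO_leP KG] := bounded K cK; exists G => //; exact: KG.
have pf : perfect_map f.
  apply: perfect_of_compact_preimages => //; first exact: zlc_hausdorff.
  move=> y; have [K cK Ky] := compact_clopen_exists y.
  exists (co_set K).
    by apply: open_nbhs_nbhs; split=> //; case: (CO_clopen K).
  have -> : f @^-1` K = co_set (phi K) by rewrite -fE.
  by apply: compact_phi; exists K.
have qf : quasi_open f.
  apply/(quasi_open_complete cf) => //; rewrite ?fE//; [exact: zlc_zero_dim..|].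
  exact: perfect_closed.
exists (exist _ f (conj qf pf)); apply: eq_exist; rewrite -fE.
by apply/funext => G; exact: val_inj.
Qed.

Section ultrafilter_space.
Variable A : zlb_algebra.

Definition ultrafilter_zlc_space : zlc_space :=
  ZLCSpace (@stone_zero_dim A) (@stone_locally_compact A) (@stone_hausdorff A).

Lemma stone_map_inverse : exists psi : CO (bounded_ultrafilter A) -> A,
  cancel (@stone_map A) psi /\ cancel psi (@stone_map A).
Proof.
have [psi psiK] := choice (@stone_map_surj A).
by exists psi; split=> // a; apply: stone_map_inj; rewrite psiK.
Qed.

End ultrafilter_space.

Lemma clopen_functor_essentially_surjective (A : opposite QPZLBA) :
  exists (X : QPZLC) (e : hom (clopen_functor X) A), isomorphism e.
Proof.
have [psi [stoneK psiK]] := stone_map_inverse A.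
have bstone := @stone_map_boolean_hom A.
exists (ultrafilter_zlc_space A).
have stoneP :
    @qpzlba_morphism A (clopen_zlb_algebra (ultrafilter_zlc_space A))
      (@stone_map A).
  apply: (@qpzlba_isomorphism A (clopen_zlb_algebra (ultrafilter_zlc_space A))
    _ _ bstone stoneK psiK) => a.
  exact: stone_set_compactP.
have psiP :
    @qpzlba_morphism (clopen_zlb_algebra (ultrafilter_zlc_space A)) A psi.
  apply: (@qpzlba_isomorphism (clopen_zlb_algebra (ultrafilter_zlc_space A)) A
    _ _ (boolean_hom_inverse bstone stoneK psiK) psiK stoneK) => U.
  rewrite -[in X in _ <-> X](psiK U); split=> /stone_set_compactP; exact.
exists (exist _ _ stoneP), (exist _ _ psiP).
by split; apply: eq_exist; apply/funext => a /=; rewrite ?psiK ?stoneK.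
Qed.

(** * The duality for compact spaces *)

Section compact_case.

Lemma continuous_compact_closed (X Y : topologicalType) (f : X -> Y) :
  compact [set: X] -> hausdorff_space Y -> continuous f ->
  forall A : set X, closed A -> closed (f @` A).
Proof.
move=> cX hY cf A cA; apply: compact_closed => //; apply: continuous_compact.
  exact: continuous_subspaceT.
exact: subclosed_compact cA cX _.
Qed.

Lemma clopen_preimage_complete (X Y : zhc_space) (f : X -> Y)
    (cf : continuous f) :
  quasi_open f -> complete_boolean_hom (clopen_preimage cf).
Proof.
move=> qf; apply/quasi_open_complete => //; [exact: zhc_zero_dim..|].
apply: (continuous_compact_closed _ _ cf).
    exact: zhc_compact.
  exact: zhc_hausdorff.
Qed.

Let clopen_map (X Y : QZHC) (f : hom X Y) :
    @hom (opposite BoolC) (BooleanAlgebra (CO X)) (BooleanAlgebra (CO Y)) :=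
  exist _ _ (clopen_preimage_complete (svalP f).1 (svalP f).2).

Let clopen_map1 (X : QZHC) : clopen_map (idm X) = idm _.
Proof. by apply: eq_exist; apply/funext => G; exact: val_inj. Qed.

Let clopen_mapM (X Y Z : QZHC) (g : hom Y Z) (f : hom X Y) :
  clopen_map (comp g f) = comp (clopen_map g) (clopen_map f).
Proof. by apply: eq_exist; apply/funext => G; exact: val_inj. Qed.

Definition stone_functor : functor QZHC (opposite BoolC) :=
  Functor clopen_map1 clopen_mapM.

Lemma stone_functor_faithful (X Y : QZHC) :
  injective (@fmap _ _ stone_functor X Y).
Proof.
move=> [f fP] [g gP] /(congr1 sval) fg; apply: eq_exist.
exact: clopen_preimage_inj (@zhc_zero_dim Y) (@zhc_hausdorff Y) fg.
Qed.

Lemma stone_functor_full (X Y : QZHC)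
    (phi : hom (stone_functor X) (stone_functor Y)) :
  exists f, fmap stone_functor f = phi.
Proof.
case: phi => phi cphi; have [bphi _] := cphi.
have [x|f [cf fE]] := boolean_hom_clopen_preimageP (@zhc_zero_dim Y) bphi.
  by exists \top%O; [exact: zhc_compact|rewrite (boolean_hom1 bphi)].
have qf : quasi_open f.
  apply/(quasi_open_complete cf) => //; rewrite ?fE//; [exact: zhc_zero_dim..|].
  apply: (continuous_compact_closed _ _ cf).
    exact: zhc_compact.
  exact: zhc_hausdorff.
exists (exist _ f (conj cf qf)); apply: eq_exist; rewrite -fE.
by apply/funext => G; exact: val_inj.
Qed.

Section improper_ideal.
Variable A : boolean_algebra.

Lemma setT_is_ideal : is_ideal [set: A].
Proof. by []. Qed.

Lemma setT_dense : dense_ideal (Ideal setT_is_ideal).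
Proof. by move=> a a0; exists a. Qed.

(** Simplicity covers [\top] by some [c] in [J] and an element disjoint from [J];
then [c] is the greatest element of [J]. *)
Lemma setT_is_zlba : is_zlba (LocalBooleanAlgebra setT_dense).
Proof.
move=> J sJ; have [c Jc cmax] : exists2 c, J c & forall e, J e -> (e <= c)%O.
  pose top : ideal_elt (Ideal setT_is_ideal) :=
    @ideal_elt_of _ _ (Ideal setT_is_ideal) \top%O I.
  have [c [d [Jc Jd topcd]]] := simple_ideal_split top sJ.
  exists c => // e Je.
  have e_top : (e <= top)%O by rewrite ideal_elt_leE; exact: lex1.
  have /meet_idPl <- := le_trans e_top topcd.
  by rewrite meetUr [X in (_ `|` X)%O]meetC Jd// joinx0 leIr.
exists (ideal_val c); split=> [_ [e Je <-]|b bub]; last by apply: bub; exists c.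
by have := cmax e Je; rewrite ideal_elt_leE.
Qed.

Definition improper_zlb_algebra : zlb_algebra := ZLBAlgebra setT_is_zlba.

End improper_ideal.

Lemma stone_functor_essentially_surjective (A : opposite BoolC) :
  exists (X : QZHC) (e : hom (stone_functor X) A), isomorphism e.
Proof.
pose A' := improper_zlb_algebra A.
have [psi [stoneK psiK]] := stone_map_inverse A'.
have bstone := @stone_map_boolean_hom A'.
have cX : compact [set: bounded_ultrafilter A'].
  by rewrite -stone_set1; exact: stone_compact.
exists (ZHCSpace (@stone_zero_dim A') cX (@stone_hausdorff A')).
exists (exist _ _ (boolean_iso_complete bstone stoneK psiK)).
exists (exist _ _ (boolean_iso_complete (boolean_hom_inverse bstone stoneK psiK)
  psiK stoneK)).
by split; apply: eq_exist; apply/funext => a /=; rewrite ?psiK ?stoneK.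
Qed.

End compact_case.

Theorem corollary2p4 :
  ((forall (X Y : topologicalType),
      zero_dim X -> locally_compact [set: X] -> hausdorff_space X ->
      zero_dim Y -> locally_compact [set: Y] -> hausdorff_space Y ->
      forall (f : X -> Y) (pf : perfect_map f),
        quasi_open f <->
        complete_boolean_hom (clopen_preimage (perfect_continuous pf))) /\
   (forall (X Y : topologicalType),
      zero_dim X -> compact [set: X] -> hausdorff_space X ->
      zero_dim Y -> compact [set: Y] -> hausdorff_space Y ->
      forall (f : X -> Y) (cf : continuous f),
        quasi_open f <-> complete_boolean_hom (clopen_preimage cf))) /\
  dually_equivalent QPZLC QPZLBA /\
  dually_equivalent QZHC BoolC.
Proof.
split; [split=> X Y zX cX _ zY _ hY f|split].
- by move=> pf; apply: quasi_open_complete => //; exact: perfect_closed.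
- move=> cf; apply: quasi_open_complete => //.
  exact: continuous_compact_closed cX hY cf.
- exact: fully_faithful_equivalence clopen_functor_faithful
    clopen_functor_full clopen_functor_essentially_surjective.
- exact: fully_faithful_equivalence stone_functor_faithful
    stone_functor_full stone_functor_essentially_surjective.
Qed.
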